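(* Let $\mathcal{M}$ be an embedded complete Riemannian submanifold of a Euclidean space (with the induced Euclidean metric). Suppose there is a constant $C$ such that the second fundamental form $B$ of $\mathcal{M}$ satisfies $\|B(\xi,\eta)\|\le C$ for all unit tangent vectors $\xi,\eta$ (at a common point of $\mathcal{M}$). Let $x,y\in\mathcal{M}$ and let $P_x^y$ be the parallel transport along the minimal geodesic from $x$ to $y$. Then for every $v\in T_x\mathcal{M}$, $$\|\operatorname{proj}_{T_y\mathcal{M}}(v)-P_x^y(v)\|\le C\,\|v\|\,\mathsf{d}(x,y).$$
   Context: $\mathsf{d}$ is the geodesic distance on $\mathcal{M}$; $\|\cdot\|$ is the Euclidean norm of the ambient space; $\operatorname{proj}_{T_y\mathcal{M}}$ is the orthogonal projection of the ambient Euclidean space onto the linear subspace $T_y\mathcal{M}$ (tangent vectors are regarded as ambient vectors). The second fundamental form is the symmetric bilinear normal-valued form $B(\xi,\eta)=\bar\nabla_{\bar\xi}\bar\eta-\nabla_\xi\eta\in(T\mathcal{M})^\perp$, where $\nabla$ is the Levi-Civita connection of $\mathcal{M}$, $\bar\nabla$ is the Euclidean directional derivative, and $\bar\xi,\bar\eta$ are extensions of the tangent vector fields $\xi,\eta$ to the ambient space. *)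

(* Defs.v *)
From HB Require Import structures.
From mathcomp Require Import all_boot all_order all_algebra.
From mathcomp Require Import all_classical all_reals all_analysis.

Set Implicit Arguments.
Unset Strict Implicit.
Unset Printing Implicit Defensive.

Import Order.TTheory GRing.Theory Num.Theory.
Import numFieldNormedType.Exports.

Local Open Scope classical_set_scope.
Local Open Scope ring_scope.

(* The library norm on 'rV[R]_n is the sup norm; it is used only for the
   topology. The Euclidean structure is given by edot and enorm. *)
Definition edot (R : realType) (n : nat) (u v : 'rV[R]_n) : R :=
  \sum_(i < n) u 0 i * v 0 i.

Definition enorm (R : realType) (n : nat) (v : 'rV[R]_n) : R :=
  Num.sqrt (edot v v).

Definition orth_proj (R : realType) (n : nat) (S : set 'rV[R]_n)
    (v : 'rV[R]_n) : 'rV[R]_n :=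
  xget 0 [set w | S w /\ forall u, S u -> edot (v - w) u = 0].

(* C^k on an open set, by recursion on the directional derivatives; in finite
   dimension this is the usual notion. *)
Fixpoint Ck (R : realType) (V W : normedModType R) (U : set V) (k : nat)
    (f : V -> W) : Prop :=
  match k with
  | 0 => forall x, U x -> {for x, continuous f}
  | k'.+1 => (forall x, U x -> differentiable f x) /\
             (forall v, Ck U k' (fun x => 'D_v f x))
  end.

Definition smooth (R : realType) (V W : normedModType R) (U : set V)
    (f : V -> W) : Prop :=
  open U /\ forall k, Ck U k f.

(* g is a smooth extension of f|A to a neighbourhood of p. *)
Definition local_extension (R : realType) (V W : normedModType R) (A : set V)
    (p : V) (f g : V -> W) : Prop :=
  exists U : set V, [/\ U p, smooth U g & forall q, U q -> A q -> g q = f q].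

(* Smoothness on an arbitrary subset A, used both for A a submanifold and for A
   an interval. Only the values of f on A matter. *)
Definition smooth_on (R : realType) (V W : normedModType R) (A : set V)
    (f : V -> W) : Prop :=
  forall p, A p -> exists g, local_extension A p f g.

(* Slice charts: near each of its points, M is carried onto
   (R^m x {0}) by a diffeomorphism F (with inverse G) of open sets of R^n. *)
Definition embedded_submanifold (R : realType) (n m : nat)
    (M : set 'rV[R]_n) : Prop :=
  (m <= n)%N /\
  forall p, M p ->
    exists (U V : set 'rV[R]_n) (F G : 'rV[R]_n -> 'rV[R]_n),
      [/\ U p, smooth U F, smooth V G,
          (forall q, U q -> V (F q) /\ G (F q) = q) /\
          (forall z, V z -> U (G z) /\ F (G z) = z) &
          forall q, U q ->
            (M q <-> forall i : 'I_n, (m <= i)%N -> F q 0 i = 0)].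

Definition curve_germ (R : realType) (n : nat) (M : set 'rV[R]_n)
    (p v : 'rV[R]_n) (c : R -> 'rV[R]_n) : Prop :=
  [/\ exists2 U : set R, U 0 & smooth U c,
      \forall t \near (0 : R), M (c t),
      c 0 = p & 'D_1 c 0 = v].

Definition tangent_space (R : realType) (n : nat) (M : set 'rV[R]_n)
    (p : 'rV[R]_n) : set 'rV[R]_n :=
  [set v | exists c, curve_germ M p v c].

(* The derivative v f = (f \o c)'(0) of a function f smooth on M, where c is
   any curve in M with c(0) = p and c'(0) = v. *)
Definition tder (R : realType) (n : nat) (M : set 'rV[R]_n)
    (f : 'rV[R]_n -> R) (p v : 'rV[R]_n) : R :=
  xget 0 [set d | exists2 c, curve_germ M p v c & d = 'D_1 (f \o c) 0].

Definition vfield (R : realType) (n : nat) (M : set 'rV[R]_n)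
    (X : 'rV[R]_n -> 'rV[R]_n) : Prop :=
  smooth_on M X /\ forall p, M p -> tangent_space M p (X p).

(* nabla p u X stands for the covariant derivative of the vector field X at p
   in the direction u of T_p M; other arguments are irrelevant. *)
Definition connection (R : realType) (n : nat) (M : set 'rV[R]_n)
    (nabla : 'rV[R]_n -> 'rV[R]_n -> ('rV[R]_n -> 'rV[R]_n) -> 'rV[R]_n)
    : Prop :=
  [/\ (forall p u X, M p -> tangent_space M p u -> vfield M X ->
         tangent_space M p (nabla p u X)) /\
      (forall p u X Y, M p -> tangent_space M p u -> vfield M X ->
         vfield M Y -> (forall q, M q -> X q = Y q) ->
         nabla p u X = nabla p u Y),
      forall X Y, vfield M X -> vfield M Y ->
        smooth_on M (fun p => nabla p (X p) Y),
      forall p u w (a : R) X, M p -> tangent_space M p u ->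
        tangent_space M p w -> vfield M X ->
        nabla p (a *: u + w) X = a *: nabla p u X + nabla p w X,
      forall p u (a : R) X Y, M p -> tangent_space M p u -> vfield M X ->
        vfield M Y ->
        nabla p u (fun q => a *: X q + Y q) = a *: nabla p u X + nabla p u Y &
      forall p u (f : 'rV[R]_n -> R) X, M p -> tangent_space M p u ->
        smooth_on M f -> vfield M X ->
        nabla p u (fun q => f q *: X q)
          = tder M f p u *: X p + f p *: nabla p u X].

(* The symmetry condition is nabla_X Y - nabla_Y X = [X, Y], both sides acting
   on smooth functions on M; the Riemannian metric is the induced one. *)
Definition levi_civita (R : realType) (n : nat) (M : set 'rV[R]_n)
    (nabla : 'rV[R]_n -> 'rV[R]_n -> ('rV[R]_n -> 'rV[R]_n) -> 'rV[R]_n)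
    : Prop :=
  [/\ connection M nabla,
      forall p X Y (f : 'rV[R]_n -> R), M p -> vfield M X -> vfield M Y ->
        smooth_on M f ->
        tder M f p (nabla p (X p) Y - nabla p (Y p) X)
          = tder M (fun q => tder M f q (Y q)) p (X p)
            - tder M (fun q => tder M f q (X q)) p (Y p) &
      forall p u X Y, M p -> tangent_space M p u -> vfield M X ->
        vfield M Y ->
        tder M (fun q => edot (X q) (Y q)) p u
          = edot (nabla p u X) (Y p) + edot (X p) (nabla p u Y)].

(* The values b = B_p(u, w), computed as D_{xi'} eta' - nabla_xi eta at p for
   tangent vector fields xi, eta with xi(p) = u, eta(p) = w, and ambient
   extensions xi', eta' of these. *)
Definition second_fform (R : realType) (n : nat) (M : set 'rV[R]_n)
    (nabla : 'rV[R]_n -> 'rV[R]_n -> ('rV[R]_n -> 'rV[R]_n) -> 'rV[R]_n)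
    (p u w b : 'rV[R]_n) : Prop :=
  exists xi eta xi' eta' : 'rV[R]_n -> 'rV[R]_n,
    [/\ vfield M xi /\ vfield M eta,
        xi p = u /\ eta p = w,
        local_extension M p xi xi',
        local_extension M p eta eta' &
        b = 'D_(xi' p) eta' p - nabla p (xi p) eta].

Definition itvcc (R : realType) (a b : R) : set R := [set` `[a, b]].

Definition itvoo (R : realType) (a b : R) : set R := [set` `]a, b[].

Definition vfield_along (R : realType) (n : nat) (M : set 'rV[R]_n)
    (gamma : R -> 'rV[R]_n) (A : set R) (Z : R -> 'rV[R]_n) : Prop :=
  smooth_on A Z /\ forall t, A t -> tangent_space M (gamma t) (Z t).

(* D is the covariant derivative D/dt induced by nabla along the smooth curve
   gamma on the open interval I. *)
Definition covariant_derivative (R : realType) (n : nat) (M : set 'rV[R]_n)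
    (nabla : 'rV[R]_n -> 'rV[R]_n -> ('rV[R]_n -> 'rV[R]_n) -> 'rV[R]_n)
    (gamma : R -> 'rV[R]_n) (I : set R)
    (D : (R -> 'rV[R]_n) -> R -> 'rV[R]_n) : Prop :=
  [/\ forall Z, vfield_along M gamma I Z -> vfield_along M gamma I (D Z),
      forall Y Z, vfield_along M gamma I Y -> vfield_along M gamma I Z ->
        (forall t, I t -> Y t = Z t) -> forall t, I t -> D Y t = D Z t,
      forall (a : R) Y Z, vfield_along M gamma I Y ->
        vfield_along M gamma I Z -> forall t, I t ->
        D (fun s => a *: Y s + Z s) t = a *: D Y t + D Z t,
      forall (g : R -> R) Z, smooth_on I g -> vfield_along M gamma I Z ->
        forall t, I t ->
        D (fun s => g s *: Z s) t = 'D_1 g t *: Z t + g t *: D Z t &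
      forall X, vfield M X -> forall t, I t ->
        D (X \o gamma) t = nabla (gamma t) ('D_1 gamma t) X].

Definition parallel (R : realType) (n : nat) (M : set 'rV[R]_n)
    (nabla : 'rV[R]_n -> 'rV[R]_n -> ('rV[R]_n -> 'rV[R]_n) -> 'rV[R]_n)
    (gamma : R -> 'rV[R]_n) (I : set R) (Z : R -> 'rV[R]_n) : Prop :=
  vfield_along M gamma I Z /\
  exists2 D, covariant_derivative M nabla gamma I D &
    forall t, I t -> D Z t = 0.

(* w is the parallel transport of v along gamma : [0, 1] -> M. The field Z is
   smooth up to the endpoints; the equation D/dt Z = 0 is imposed on the open
   interval (where 'D_1 is not affected by values of gamma and Z outside
   [0, 1]), and extends to the endpoints by continuity. *)
Definition parallel_transport (R : realType) (n : nat) (M : set 'rV[R]_n)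
    (nabla : 'rV[R]_n -> 'rV[R]_n -> ('rV[R]_n -> 'rV[R]_n) -> 'rV[R]_n)
    (gamma : R -> 'rV[R]_n) (v w : 'rV[R]_n) : Prop :=
  exists Z : R -> 'rV[R]_n,
    [/\ vfield_along M gamma (itvcc 0 1) Z,
        parallel M nabla gamma (itvoo 0 1) Z, Z 0 = v & Z 1 = w].

Definition geodesic (R : realType) (n : nat) (M : set 'rV[R]_n)
    (nabla : 'rV[R]_n -> 'rV[R]_n -> ('rV[R]_n -> 'rV[R]_n) -> 'rV[R]_n)
    (gamma : R -> 'rV[R]_n) : Prop :=
  [/\ smooth_on (itvcc 0 1) gamma,
      forall t, itvcc 0 1 t -> M (gamma t) &
      parallel M nabla gamma (itvoo 0 1) (fun t => 'D_1 gamma t)].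

Definition curve_length (R : realType) (n : nat) (c : R -> 'rV[R]_n) : \bar R :=
  \int[lebesgue_measure]_(t in itvcc 0 1) (enorm ('D_1 c t))%:E.

(* Piecewise smooth curve [0, 1] -> M from x to y: s lists the subdivision
   points after 0 and ends with 1. *)
Definition pw_smooth_curve (R : realType) (n : nat) (M : set 'rV[R]_n)
    (x y : 'rV[R]_n) (c : R -> 'rV[R]_n) : Prop :=
  [/\ c 0 = x, c 1 = y, forall t, itvcc 0 1 t -> M (c t) &
      exists s : seq R,
        [/\ path <%R 0 s, last 0 s = 1 &
            forall i : nat, (i < size s)%N ->
              smooth_on (itvcc (nth 0 (0 :: s) i) (nth 0 s i)) c]].

Definition geodesic_dist (R : realType) (n : nat) (M : set 'rV[R]_n)
    (x y : 'rV[R]_n) : \bar R :=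
  ereal_inf [set curve_length c | c in pw_smooth_curve M x y].

Definition dist_Cauchy (R : realType) (n : nat) (M : set 'rV[R]_n)
    (u : nat -> 'rV[R]_n) : Prop :=
  forall e : R, 0 < e -> exists N : nat, forall i j : nat,
    (N <= i)%N -> (N <= j)%N -> (geodesic_dist M (u i) (u j) < e%:E)%E.

Definition complete_submanifold (R : realType) (n : nat)
    (M : set 'rV[R]_n) : Prop :=
  forall u : nat -> 'rV[R]_n, (forall k, M (u k)) -> dist_Cauchy M u ->
    exists2 l, M l & geodesic_dist M (u k) l @[k --> \oo] --> 0%E.

Definition minimal_geodesic (R : realType) (n : nat) (M : set 'rV[R]_n)
    (nabla : 'rV[R]_n -> 'rV[R]_n -> ('rV[R]_n -> 'rV[R]_n) -> 'rV[R]_n)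
    (x y : 'rV[R]_n) (gamma : R -> 'rV[R]_n) : Prop :=
  [/\ geodesic M nabla gamma, gamma 0 = x, gamma 1 = y &
      curve_length gamma = geodesic_dist M x y].

(* Main.v *)
Require Import Defs.
From HB Require Import structures.
From mathcomp Require Import all_boot all_order all_algebra.
From mathcomp Require Import all_classical all_reals all_analysis.
From mathcomp Require Import lra measurable_realfun.
Import Order.TTheory GRing.Theory Num.Theory.
Import numFieldNormedType.Exports.
Local Open Scope classical_set_scope.
Local Open Scope ring_scope.

Set Implicit Arguments.
Unset Strict Implicit.
Unset Printing Implicit Defensive.

(** Along the minimal geodesic [gamma], the parallel field [Z] from [v] to [w]
    satisfies [Z' = B(gamma', Z)].  To see this at a fixed time [t], extend [Z t]
    to the global tangent field [eta q] = orthogonal projection of [Z t] onto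
    [T_q M], and expand [Z] in the projections of the coordinate vectors: the
    derivation rules for [D/dt] and for [d/dt] then have the same first-order
    terms, whence [Z' t = (eta o gamma)' t - nabla_(gamma' t) eta].  Metric
    compatibility makes [Z] orthogonal to [Z'], so [|Z| = |v|], and likewise the
    speed [|gamma'|] is a constant [s], which is the distance from [x] to [y].
    Hence [|Z'| <= C |v| s], and the mean value theorem bounds
    [|w - v| = |Z 1 - Z 0|]; projecting [v] onto [T_y M], which contains [w], can
    only decrease the distance to [w]. *)

(** * C^k functions *)

Section CkGeneral.
Variables (R : realType) (V W : normedModType R).
Implicit Types (U : set V) (f g : V -> W).

Lemma Ck_subset U U' k f : U' `<=` U -> Ck U k f -> Ck U' k f.
Proof.
elim: k f => [|k IH] f sub /=; first by move=> h x /sub /h.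
by case=> h1 h2; split=> [x /sub /h1 //|v]; apply: IH (h2 v).
Qed.

Lemma CkW U k f : Ck U k.+1 f -> Ck U k f.
Proof.
elim: k f => [|k IH] f; last by case=> h1 h2; split=> // v; exact: IH (h2 v).
by case=> h _ x /h; exact: differentiable_continuous.
Qed.

(** The first-order expansion of [f] at [x] is also one of [g], and its linear part is continuous,
    so it is the differential of [g]. *)
Lemma near_eq_differentiable (f g : V -> W) x :
  {near x, f =1 g} -> differentiable f x -> differentiable g x.
Proof.
move=> fg df.
have eg : g \o shift x = cst (g x) + 'd f x +o_ 0 id.
  apply/eqaddoP => e e0.
  have /eqaddoP/(_ e e0) := diff_locally df.
  have nfg : \forall h \near (0 : V), f (h + x) = g (h + x).
    by move: fg; rewrite /= (near_shift (0 : V) x); rewrite subr0.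
  apply: filter_app; near=> h => /=.
  rewrite (nbhs_singleton fg) !fctE /=.
  suff -> : f (h + x) = g (h + x) by [].
  by near: h.
have cd : continuous ('d f x) by exact: diff_continuous.
by apply/diff_locallyP; rewrite (diff_unique cd eg).
Unshelve. all: by end_near. Qed.

(** The rules of calculus give derivatives on [U] only, while [Ck] speaks of total functions;
    openness of [U] lets equality on [U] pass to the derivatives. *)
Lemma Ck_ext U k f g :
  open U -> (forall x, U x -> f x = g x) -> Ck U k f -> Ck U k g.
Proof.
move=> oU.
have nU x f1 f2 : U x -> (forall z, U z -> f1 z = f2 z) -> {near x, f1 =1 f2 :> (V -> W)}.
  by move=> Ux h; apply: filterS (open_nbhs_nbhs (conj oU Ux)) => z; exact: h.
elim: k f g => [|k IH] f g fg /=.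
  move=> h x Ux; have := h x Ux; rewrite /prop_for /continuous_at (fg x Ux).
  by apply: cvg_trans; apply: near_eq_cvg; apply: nU Ux _ => z /fg.
case=> h1 h2; split=> [x Ux|v].
  exact: near_eq_differentiable (nU _ _ _ Ux fg) (h1 x Ux).
apply: IH (h2 v) => x Ux; exact: near_eq_derive (nU _ _ _ Ux fg).
Qed.

Lemma Ck_cst U k (a : W) : Ck U k (fun=> a).
Proof.
elim: k a => [|k IH] a /=; first by move=> x _; exact: cvg_cst.
split=> [x _|v]; first exact: differentiable_cst.
by under eq_fun do rewrite derive_cst; exact: IH.
Qed.

Lemma CkD U k f g : open U -> Ck U k f -> Ck U k g ->
  Ck U k (fun x => f x + g x).
Proof.
move=> oU; elim: k f g => [|k IH] f g /=.
  by move=> h1 h2 x Ux; apply: cvgD; [exact: h1|exact: h2].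
move=> [f1 f2] [g1 g2]; split=> [x Ux|v].
  by apply: differentiableD; [exact: f1|exact: g1].
apply: (@Ck_ext _ _ (fun x => 'D_v f x + 'D_v g x)) => //; last exact: IH.
by move=> x Ux; rewrite (deriveD (diff_derivable (f1 x Ux)) (diff_derivable (g1 x Ux))).
Qed.

Lemma Ck_sum U k (I : Type) (r : seq I) (P : pred I) (h : I -> V -> W) :
  open U -> (forall i, P i -> Ck U k (h i)) ->
  Ck U k (fun x => \sum_(i <- r | P i) h i x).
Proof.
move=> oU hh; elim: r => [|i r IH].
  by under eq_fun do rewrite big_nil; exact: Ck_cst.
under eq_fun do rewrite big_cons.
by case: (boolP (P i)) => // Pi; apply: CkD => //; exact: hh.
Qed.

End CkGeneral.

Lemma CkZl (R : realType) (V W : normedModType R) (U : set V) k (h : V -> R) (a : W) :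
  open U -> Ck U k h -> Ck U k (fun x => h x *: a).
Proof.
move=> oU; elim: k h => [|k IH] h.
  by move=> hc x Ux; apply: cvgZr_tmp; exact: hc.
move=> [h1 h2]; split=> [x Ux|v]; first exact/differentiableZl/h1.
apply: (@Ck_ext _ _ _ _ _ (fun x => 'D_v h x *: a)) => //; last exact: IH (h2 v).
move=> x Ux; have dh := h1 x Ux.
by rewrite !deriveE ?diffZl //; exact: differentiableZl.
Qed.

Section CkScalar.
Variables (R : realType) (V : normedModType R).
Implicit Types (U : set V) (f g : V -> R).

Lemma CkM U k f g : open U -> Ck U k f -> Ck U k g ->
  Ck U k (fun x => f x * g x).
Proof.
move=> oU; elim: k f g => [|k IH] f g.
  by move=> h1 h2 x Ux; apply: cvgM; [exact: h1|exact: h2].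
move=> cf cg; have [f1 f2] := cf; have [g1 g2] := cg; split=> [x Ux|v].
by have df := f1 x Ux; have dg := g1 x Ux; apply: differentiableM.
apply: (@Ck_ext _ _ _ _ _ (fun x => f x * 'D_v g x + g x * 'D_v f x)) => //.
  by move=> x Ux; rewrite (deriveM (diff_derivable (f1 x Ux)) (diff_derivable (g1 x Ux))).
by apply: CkD => //; apply: IH; [exact: CkW|exact: g2|exact: CkW|exact: f2].
Qed.

Lemma Ck_prod U k (I : Type) (r : seq I) (P : pred I) (h : I -> V -> R) :
  open U -> (forall i, P i -> Ck U k (h i)) ->
  Ck U k (fun x => \prod_(i <- r | P i) h i x).
Proof.
move=> oU hh; elim: r => [|i r IH].
  by under eq_fun do rewrite big_nil; exact: Ck_cst.
under eq_fun do rewrite big_cons.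
by case: (boolP (P i)) => // Pi; apply: CkM => //; exact: hh.
Qed.

(** The derivative of [1/f] is [-(1/f)^2] times that of [f]; with [f] fixed, the induction
    hypothesis covers [1/f] at one order less. *)
Lemma CkV U k f : open U -> (forall x, U x -> f x != 0) -> Ck U k f ->
  Ck U k (fun x => (f x)^-1).
Proof.
move=> oU f0; elim: k => [|k IH].
  by move=> h x Ux; apply: cvgV; [exact: f0|exact: h].
move=> cf; have [f1 f2] := cf; split=> [x Ux|v].
  by apply: differentiableV; [exact: f1|exact: f0].
have cV := IH (CkW cf).
apply: (@Ck_ext _ _ _ _ _ (fun x => -1 * ((f x)^-1 * (f x)^-1) * 'D_v f x)) => //.
  move=> x Ux; have := deriveV (f0 x Ux) (diff_derivable (v := v) (f1 x Ux)).
  by move=> ->; rewrite /GRing.scale /= expr2 invfM mulN1r.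
by apply: CkM; [|apply: CkM; [|exact: Ck_cst|exact: CkM]|exact: f2].
Qed.

End CkScalar.

Section CkMatrix.
Variables (R : realType) (V : normedModType R) (m n : nat).
Implicit Types (U : set V) (f : V -> 'M[R]_(m, n)).

Lemma differentiable_entry f i j x :
  differentiable f x -> differentiable (fun z => f z i j) x.
Proof.
move=> h; apply: (@differentiable_comp _ _ _ _ f (fun N => N i j)) => //.
exact: differentiable_coord.
Qed.

Lemma derive_entry f i j v x :
  differentiable f x -> 'D_v (fun z => f z i j) x = 'D_v f x i j.
Proof. by move=> /(diff_derivable (v := v)) h; rewrite derive_mx // mxE. Qed.

Lemma Ck_entry U k f i j : open U -> Ck U k f -> Ck U k (fun x => f x i j).
Proof.
move=> oU; elim: k f => [|k IH] f /=.
  move=> h x Ux; apply: (@continuous_comp _ _ _ f (fun M : 'M[R]_(m, n) => M i j)).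
    exact: h.
  exact: coord_continuous.
case=> h1 h2; split=> [x Ux|v]; first exact/differentiable_entry/h1.
apply: (@Ck_ext _ _ _ _ _ (fun x => 'D_v f x i j)) => //; last exact: IH.
by move=> x Ux; rewrite derive_entry //; exact: h1.
Qed.

Lemma Ck_mx U k f : open U -> (forall i j, Ck U k (fun x => f x i j)) -> Ck U k f.
Proof.
move=> oU h; rewrite (_ : f = fun x => \sum_i \sum_j f x i j *: delta_mx i j); last first.
  by apply/funext => x; exact: matrix_sum_delta.
by apply: Ck_sum => // i _; apply: Ck_sum => // j _; exact: CkZl.
Qed.

End CkMatrix.

Lemma derive_comp (R : realType) (V W1 W2 : normedModType R)
    (f : W1 -> W2) (g : V -> W1) v x :
  differentiable g x -> differentiable f (g x) ->
  'D_v (f \o g) x = 'D_('D_v g x) f (g x).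
Proof.
move=> dg df; rewrite (deriveE v (differentiable_comp dg df)) (diff_comp dg df).
by rewrite (deriveE _ df) (deriveE _ dg).
Qed.

Lemma derive_dirE (R : realType) (n : nat) (W : normedModType R)
    (f : 'rV[R]_n -> W) (p u : 'rV[R]_n) : differentiable f p ->
  'D_u f p = \sum_i u 0 i *: 'D_(delta_mx 0 i) f p.
Proof.
move=> df; rewrite (deriveE _ df) [u in LHS]row_sum_delta linear_sum.
by apply: eq_bigr => i _; rewrite linearZ (deriveE _ df).
Qed.

(** * Composition of C^k maps *)

Section CkComp.
Variables (R : realType) (V : normedModType R) (n : nat).
Variables (U : set V) (U' : set 'rV[R]_n) (g : V -> 'rV[R]_n).
Hypotheses (oU : open U) (gU : forall x, U x -> U' (g x)).

(** By the chain rule in coordinates a derivative of [f \o g] is a sum of products of components of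
    ['D_v g] with partial derivatives of [f] composed with [g]; the induction hypothesis is applied
    to these partial derivatives. *)
Lemma Ck_comp_scalar k (f : 'rV[R]_n -> R) :
  Ck U' k f -> Ck U k g -> Ck U k (f \o g).
Proof.
elim: k f => [|k IH] f cf cg.
  by move=> x Ux; apply: continuous_comp; [exact: cg|exact/cf/gU].
have [f1 f2] := cf; have [g1 g2] := cg; split=> [x Ux|v].
  by apply: differentiable_comp; [exact: g1|exact/f1/gU].
apply: (@Ck_ext _ _ _ _ _ (fun x => \sum_i 'D_v g x 0 i *
    ('D_(delta_mx 0 i) f \o g) x)) => //.
  move=> x Ux; have df := f1 _ (gU Ux).
  by rewrite (derive_comp _ (g1 _ Ux) df) (derive_dirE _ df).
apply: Ck_sum => // i _; apply: CkM => //; first exact: Ck_entry (g2 v).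
by apply: IH; [exact: f2|exact: CkW].
Qed.

Lemma Ck_comp k p q (f : 'rV[R]_n -> 'M[R]_(p, q)) : open U' ->
  Ck U' k f -> Ck U k g -> Ck U k (f \o g).
Proof.
move=> oU' cf cg; apply: Ck_mx => // i j.
by apply: (@Ck_comp_scalar _ (fun z => f z i j)) => //; exact: Ck_entry.
Qed.

End CkComp.

(** * Products, determinants and inverses of C^k matrices *)

Section CkMatrixAlgebra.
Variables (R : realType) (V : normedModType R) (U : set V) (k : nat).
Hypothesis oU : open U.

Lemma CkZ p q (f : V -> R) (A : V -> 'M[R]_(p, q)) :
  Ck U k f -> Ck U k A -> Ck U k (fun x => f x *: A x).
Proof.
move=> cf cA; apply: Ck_mx => // i j.
under eq_fun do rewrite mxE.
by apply: CkM => //; exact: Ck_entry.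
Qed.

Lemma Ck_mulmx p q r (A : V -> 'M[R]_(p, q)) (B : V -> 'M[R]_(q, r)) :
  Ck U k A -> Ck U k B -> Ck U k (fun x => A x *m B x).
Proof.
move=> cA cB; apply: Ck_mx => // i j.
under eq_fun do rewrite mxE.
by apply: Ck_sum => // l _; apply: CkM => //; exact: Ck_entry.
Qed.

Lemma Ck_trmx p q (A : V -> 'M[R]_(p, q)) : Ck U k A -> Ck U k (fun x => (A x)^T).
Proof.
move=> cA; apply: Ck_mx => // i j.
by under eq_fun do rewrite mxE; exact: Ck_entry.
Qed.

Lemma Ck_det n (A : V -> 'M[R]_n) : Ck U k A -> Ck U k (fun x => \det (A x)).
Proof.
move=> cA; rewrite /determinant; apply: Ck_sum => // s _; apply: CkM => //.
  exact: Ck_cst.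
by apply: Ck_prod => // i _; exact: Ck_entry.
Qed.

(** Cramer's formula: the entries of the inverse are polynomials in the entries of [A], divided by a
    determinant that does not vanish on [U]. *)
Lemma Ck_invmx n (A : V -> 'M[R]_n) : (forall x, U x -> A x \in unitmx) ->
  Ck U k A -> Ck U k (fun x => invmx (A x)).
Proof.
move=> uA cA; apply: (@Ck_ext _ _ _ _ _ (fun x => (\det (A x))^-1 *: \adj (A x))) => //.
  by move=> x Ux; rewrite /invmx uA.
apply: CkZ.
  apply: CkV => //; last exact: Ck_det.
  by move=> x /uA; rewrite unitmxE unitfE.
apply: Ck_mx => // i j; under eq_fun do rewrite mxE /cofactor.
apply: CkM => //; first exact: Ck_cst.
apply: Ck_det; apply: Ck_mx => // a b; under eq_fun do rewrite !mxE.
exact: Ck_entry.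
Qed.

Lemma Ck_edot n (f g : V -> 'rV[R]_n) :
  Ck U k f -> Ck U k g -> Ck U k (fun x => edot (f x) (g x)).
Proof.
by move=> cf cg; apply: Ck_sum => // i _; apply: CkM => //; exact: Ck_entry.
Qed.

End CkMatrixAlgebra.

Lemma open_preimage_in (R : realType) (V W : normedModType R) (U : set V)
    (U' : set W) (g : V -> W) : open U -> open U' ->
  (forall x, U x -> {for x, continuous g}) -> open (U `&` g @^-1` U').
Proof.
move=> oU oU' cg; rewrite openE => x [Ux U'gx]; apply: filterI.
  exact: open_nbhs_nbhs.
by apply: (cg x Ux); exact: open_nbhs_nbhs.
Qed.

(** * Smoothness on an arbitrary subset *)

Section SmoothOn.
Variables (R : realType) (V : normedModType R).
Implicit Type A : set V.

Lemma smooth_differentiable (W : normedModType R) (U : set V) (f : V -> W) x :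
  smooth U f -> U x -> differentiable f x.
Proof. by case=> _ /(_ 1) [h _]; exact: h. Qed.

Lemma smooth_continuous (W : normedModType R) (U : set V) (f : V -> W) x :
  smooth U f -> U x -> {for x, continuous f}.
Proof. by case=> _ /(_ 0) h; exact: h. Qed.

Lemma smooth_near (W : normedModType R) (U : set V) (f : V -> W) x :
  smooth U f -> U x -> nbhs x U.
Proof. by move=> [oU _] Ux; exact: open_nbhs_nbhs. Qed.

Lemma smooth_comp n p q (U : set V) (U' : set 'rV[R]_n) (g : V -> 'rV[R]_n)
    (f : 'rV[R]_n -> 'M[R]_(p, q)) :
  smooth U g -> smooth U' f -> smooth (U `&` g @^-1` U') (f \o g).
Proof.
move=> sg [oU' cf]; have oW : open (U `&` g @^-1` U').
  apply: open_preimage_in => //; first by case: sg.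
  by move=> x; exact: smooth_continuous.
split=> // k; apply: (@Ck_comp _ _ _ _ U') => //; first by move=> x [].
by apply: (Ck_subset _ (sg.2 k)) => x [].
Qed.

Lemma smooth_on_subset (W : normedModType R) A A' (f : V -> W) :
  A' `<=` A -> smooth_on A f -> smooth_on A' f.
Proof.
move=> sub h p /[dup] A'p /sub /h [g [U [Up sg gf]]].
by exists g, U; split=> // q Uq /sub; exact: gf.
Qed.

Lemma smooth_on_near (W : normedModType R) A (f : V -> W) x :
  smooth_on A f -> nbhs x A ->
  exists2 g, (exists2 U : set V, U x & smooth U g) & {near x, f =1 g}.
Proof.
move=> sf nA; have [g [U [Ux sg gf]]] := sf x (nbhs_singleton nA).
exists g; first by exists U.
by near=> z; apply/esym/gf; near: z => //; exact: smooth_near sg Ux.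
Unshelve. all: by end_near. Qed.

Lemma smooth_on_differentiable (W : normedModType R) A (f : V -> W) x :
  smooth_on A f -> nbhs x A -> differentiable f x.
Proof.
move=> sf nA; have [g [U Ux sg] fg] := smooth_on_near sf nA.
apply: (@near_eq_differentiable _ _ _ g); last exact: smooth_differentiable sg Ux.
by apply: filterS fg => z ->.
Qed.

Lemma smooth_on_within_continuous (W : normedModType R) A (f : V -> W) :
  smooth_on A f -> {within A, continuous f}.
Proof.
move=> sf; apply/subspace_continuousP => x Ax.
have [g [U [Ux sg gf]]] := sf x Ax.
have cg : g @ within A (nbhs x) --> f x.
  by rewrite -(gf x Ux Ax); exact: cvg_within_filter (smooth_continuous sg Ux).
apply: cvg_trans cg.
apply: near_eq_cvg; rewrite near_withinE; near=> z => Az; apply: gf => //.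
by near: z; exact: smooth_near sg Ux.
Unshelve. all: by end_near. Qed.

Lemma smooth_on_comp n p q A (M : set 'rV[R]_n) (g : V -> 'rV[R]_n)
    (f : 'rV[R]_n -> 'M[R]_(p, q)) :
  smooth_on A g -> (forall x, A x -> M (g x)) -> smooth_on M f ->
  smooth_on A (f \o g).
Proof.
move=> sg gM sf x Ax; have [g' [U [Ux sg' gg']]] := sg x Ax.
have [f' [U' [U'x sf' ff']]] := sf _ (gM x Ax).
exists (f' \o g'), (U `&` g' @^-1` U'); split; first by split=> //=; rewrite gg'.
  exact: smooth_comp.
move=> z [Uz /=]; rewrite /preimage /= => U'z Az.
by rewrite gg' // in U'z *; rewrite ff' //; exact: gM.
Qed.

(** The operation is abstract so that scaling, addition and the inner product share one proof: local
    extensions are combined on the intersection of their domains. *)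
Lemma smooth_on_op2 (W1 W2 W : normedModType R) (op : W1 -> W2 -> W) A
    (f : V -> W1) (g : V -> W2) :
  (forall (U : set V) k f1 g1, open U -> Ck U k f1 -> Ck U k g1 ->
    Ck U k (fun x => op (f1 x) (g1 x))) ->
  smooth_on A f -> smooth_on A g -> smooth_on A (fun x => op (f x) (g x)).
Proof.
move=> Ck_op sf sg x Ax; have [f' [U [Ux [oU cf] ff']]] := sf x Ax.
have [g' [U' [U'x [oU' cg] gg']]] := sg x Ax.
have oW := openI oU oU'.
exists (fun z => op (f' z) (g' z)), (U `&` U'); split=> //.
  split=> // k; apply: Ck_op => //.
    by apply: (Ck_subset _ (cf k)) => z [].
  by apply: (Ck_subset _ (cg k)) => z [].
by move=> z [Uz U'z] Az; rewrite ff' // gg'.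
Qed.

Lemma smooth_onZ p q A (f : V -> R) (g : V -> 'M[R]_(p, q)) :
  smooth_on A f -> smooth_on A g -> smooth_on A (fun x => f x *: g x).
Proof.
apply: (smooth_on_op2 (op := fun (a : R) (b : 'M[R]_(p, q)) => a *: b)).
by move=> U k f1 g1 oU c1 c2; exact: (CkZ oU c1 c2).
Qed.

Lemma smooth_onD (W : normedModType R) A (f g : V -> W) :
  smooth_on A f -> smooth_on A g -> smooth_on A (fun x => f x + g x).
Proof.
by apply: (smooth_on_op2 (op := fun a b : W => a + b)) => U k f1 g1; exact: CkD.
Qed.

Lemma smooth_on_edot n A (f g : V -> 'rV[R]_n) :
  smooth_on A f -> smooth_on A g -> smooth_on A (fun x => edot (f x) (g x)).
Proof.
apply: (smooth_on_op2 (op := @edot R n)) => U k f1 g1 oU c1 c2.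
exact: (Ck_edot oU c1 c2).
Qed.

Lemma smooth_on_cst (W : normedModType R) A (a : W) : smooth_on A (fun=> a).
Proof.
move=> x _; exists (fun=> a), setT; split=> //; split; first exact: openT.
by move=> k; exact: Ck_cst.
Qed.

Lemma smooth_on_entry p q A (f : V -> 'M[R]_(p, q)) i j :
  smooth_on A f -> smooth_on A (fun x => f x i j).
Proof.
move=> sf x Ax; have [f' [U [Ux [oU cf] ff']]] := sf x Ax.
exists (fun z => f' z i j), U; split=> //.
  by split=> // k; exact: Ck_entry.
by move=> z Uz Az; rewrite ff'.
Qed.

End SmoothOn.

(** * Euclidean geometry and orthogonal projectors *)

Section Euclidean.
Variables (R : realType) (n : nat).
Implicit Types u v w : 'rV[R]_n.

Lemma edotE u v : edot u v = (u *m v^T) 0 0.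
Proof. by rewrite mxE; apply: eq_bigr => i _; rewrite mxE. Qed.

Lemma edotC u v : edot u v = edot v u.
Proof. by apply: eq_bigr => i _; rewrite mulrC. Qed.

Lemma edotDl u v w : edot (u + v) w = edot u w + edot v w.
Proof. by rewrite !edotE mulmxDl mxE. Qed.

Lemma edotZl a u w : edot (a *: u) w = a * edot u w.
Proof. by rewrite !edotE -scalemxAl mxE. Qed.

Lemma edotBl u v w : edot (u - v) w = edot u w - edot v w.
Proof. by rewrite -[- v]scaleN1r edotDl edotZl mulN1r. Qed.

Lemma edotDr u v w : edot w (u + v) = edot w u + edot w v.
Proof. by rewrite !(edotC w) edotDl. Qed.

Lemma edotBr u v w : edot w (u - v) = edot w u - edot w v.
Proof. by rewrite !(edotC w) edotBl. Qed.

Lemma edotZr a u w : edot w (a *: u) = a * edot w u.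
Proof. by rewrite !(edotC w) edotZl. Qed.

Lemma edot0l u : edot 0 u = 0.
Proof. by rewrite edotE mul0mx mxE. Qed.

Lemma edot_ge0 u : 0 <= edot u u.
Proof. by apply: sumr_ge0 => i _; rewrite -expr2 sqr_ge0. Qed.

Lemma edot_eq0 u : edot u u = 0 -> u = 0.
Proof.
move=> /eqP; rewrite psumr_eq0 => [/allP h|i _]; last by rewrite -expr2 sqr_ge0.
apply/rowP => i; have := h i (mem_index_enum i).
by rewrite /= mulf_eq0 orbb mxE => /eqP.
Qed.

Lemma edot_mulmx u v (A : 'M[R]_n) : edot (u *m A) v = edot u (v *m A^T).
Proof. by rewrite !edotE trmx_mul trmxK mulmxA. Qed.

Lemma enorm_ge0 u : 0 <= enorm u.
Proof. exact: sqrtr_ge0. Qed.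

Lemma enorm_sqr u : enorm u ^+ 2 = edot u u.
Proof. by rewrite sqr_sqrtr // edot_ge0. Qed.

Lemma enorm_eq0 u : enorm u = 0 -> u = 0.
Proof. by move=> h; apply: edot_eq0; rewrite -enorm_sqr h expr0n. Qed.

Lemma enormZ a u : enorm (a *: u) = `|a| * enorm u.
Proof. by rewrite /enorm edotZl edotZr mulrA -expr2 sqrtrM ?sqr_ge0 // sqrtr_sqr. Qed.

(** Cauchy-Schwarz: with [a = |u|] and [b = |v|], expanding [|b u - a v|^2 >= 0] gives
    [2 a b (a b - edot u v) >= 0]. *)
Lemma edot_le u v : edot u v <= enorm u * enorm v.
Proof.
have [->|u0] := eqVneq u 0.
  by rewrite edot0l mulr_ge0 ?enorm_ge0.
have nu : 0 < enorm u.
  by rewrite lt_neqAle enorm_ge0 andbT eq_sym; apply: contra_neq u0; exact: enorm_eq0.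
have := edot_ge0 (enorm v *: u - enorm u *: v).
rewrite edotBl !edotBr !edotZl !edotZr -!enorm_sqr (edotC v u).
have [->|v0] := eqVneq v 0.
  by rewrite edotC edot0l mulr_ge0 ?enorm_ge0.
have nv : 0 < enorm v.
  by rewrite lt_neqAle enorm_ge0 andbT eq_sym; apply: contra_neq v0; exact: enorm_eq0.
set a := enorm u; set b := enorm v; set c := edot u v => h.
have : 0 <= (a * b) * (a * b - c) by nra.
by rewrite pmulr_rge0 ?mulr_gt0 // subr_ge0.
Qed.

(* Kato's formula: the orthogonal projector onto the range of an oblique
   projector [Q] is [(Q + Q^T - 1)^-1 Q], hence as smooth as [Q]. *)
Definition ortho_of_idem (Q : 'M[R]_n) : 'M[R]_n := invmx (Q + Q^T - 1%:M) *m Q.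

Section Idempotent.
Variable Q : 'M[R]_n.
Hypothesis QQ : Q *m Q = Q.
Let QQT : Q^T *m Q^T = Q^T.
Proof. by rewrite -trmx_mul QQ. Qed.

(** For [u] in the kernel, multiplying by [Q^T] leaves [u Q Q^T = 0], so [|u Q|^2 = 0]; likewise
    [u Q^T = 0], and the kernel equation becomes [- u = 0]. *)
Lemma idem_unitmx : Q + Q^T - 1%:M \in unitmx.
Proof.
rewrite -row_free_unit; apply/inj_row_free => u.
rewrite mulmxBr mulmxDr mulmx1 => h.
have hQ : u *m Q = 0.
  have := congr1 (mulmx^~ Q^T) h.
  rewrite /= mul0mx mulmxBl mulmxDl -!mulmxA QQT addrK mulmxA => h1.
  by apply: edot_eq0; rewrite edot_mulmx h1 edotE trmx0 mulmx0 mxE.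
have hQT : u *m Q^T = 0.
  have := congr1 (mulmx^~ Q) h.
  rewrite /= mul0mx mulmxBl mulmxDl -!mulmxA QQ addrAC subrr add0r mulmxA => h1.
  by apply: edot_eq0; rewrite edot_mulmx trmxK h1 edotE trmx0 mulmx0 mxE.
by move: h; rewrite hQ hQT !add0r => /eqP; rewrite oppr_eq0 => /eqP.
Qed.

Lemma ortho_of_idem_range u : (u *m ortho_of_idem Q) *m Q = u *m ortho_of_idem Q.
Proof. by rewrite /ortho_of_idem -!mulmxA QQ. Qed.

(** With [S = Q + Q^T - 1], idempotence gives [S Q^T = Q Q^T], that is [S^-1 Q Q^T = Q^T]. So [Q^T]
    kills the residual, which is thus orthogonal to every [w = w Q]. *)
Lemma ortho_of_idem_orth u w : w *m Q = w -> edot (u - u *m ortho_of_idem Q) w = 0.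
Proof.
move=> <-; rewrite edotC edot_mulmx.
rewrite mulmxBl -mulmxA (_ : ortho_of_idem Q *m Q^T = Q^T) ?subrr.
  by rewrite edotE trmx0 mulmx0 mxE.
rewrite /ortho_of_idem -mulmxA -[RHS](mulKmx idem_unitmx).
by congr (_ *m _); rewrite mulmxBl mulmxDl QQT mul1mx addrK.
Qed.

End Idempotent.

(** Two candidates [z] and [w] differ by an element of [S] equal to [(v - w) - (v - z)], hence
    orthogonal to itself; the existence of [w] rules out the default value of [xget]. *)
Lemma orth_proj_unique (S : set 'rV[R]_n) v w :
  (forall u1 u2, S u1 -> S u2 -> S (u1 - u2)) -> S w ->
  (forall u, S u -> edot (v - w) u = 0) -> orth_proj S v = w.
Proof.
move=> SB Sw ow; rewrite /orth_proj.
case: xgetP => [z _ [Sz oz]|/(_ w) []] //.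
apply/eqP; rewrite -subr_eq0; apply/eqP/edot_eq0.
have Szw := SB _ _ Sz Sw.
have {1}-> : z - w = (v - w) - (v - z) by rewrite opprB [RHS]addrC subrKA.
by rewrite edotBl ow // oz // subrr.
Qed.

End Euclidean.

(** * Tangent spaces of an embedded submanifold *)

Lemma Ck_id (R : realType) (V : normedModType R) (U : set V) k : Ck U k (@id V).
Proof.
case: k => [|k]; first by move=> x _; exact: cvg_id.
split=> [x _|v]; first exact: ex_diff.
by under eq_fun do rewrite derive_id; exact: Ck_cst.
Qed.

(* Locked: matching [_ *m _] against a bare [jacobian] would unfold the differential. *)
Definition jac (R : realType) (n p : nat) (f : 'rV[R]_n -> 'rV[R]_p) q : 'M[R]_(n, p) :=
  locked (jacobian f q).

Lemma mul_jac (R : realType) (n p : nat) (f : 'rV[R]_n -> 'rV[R]_p) q u :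
  differentiable f q -> u *m jac f q = 'D_u f q.
Proof. by move=> df; rewrite /jac -lock deriveEjacobian. Qed.

Lemma Ck_jac (R : realType) (n p : nat) (U : set 'rV[R]_n)
    (f : 'rV[R]_n -> 'rV[R]_p) k : smooth U f -> Ck U k (jac f).
Proof.
move=> sf; have [oU cf] := sf; apply: Ck_mx => // i j.
apply: (@Ck_ext _ _ _ _ _ (fun q => 'D_(delta_mx 0 i) f q 0 j)) => //.
  move=> q Uq; rewrite -mul_jac; last exact: smooth_differentiable sf Uq.
  by rewrite -rowE mxE.
exact: Ck_entry oU ((cf k.+1).2 _).
Qed.

Lemma jac_inverse (R : realType) (n : nat) (U V : set 'rV[R]_n)
    (F G : 'rV[R]_n -> 'rV[R]_n) q : smooth U F -> smooth V G ->
  (forall z, U z -> V (F z) /\ G (F z) = z) -> U q ->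
  jac F q *m jac G (F q) = 1%:M.
Proof.
move=> sF sG FG Uq; have [VFq _] := FG q Uq.
have dF := smooth_differentiable sF Uq; have dG := smooth_differentiable sG VFq.
apply/row_matrixP => i; rewrite !rowE mulmxA !mul_jac // -derive_comp // mulmx1.
rewrite (@near_eq_derive _ _ _ _ id) ?derive_id //.
by apply: filterS (smooth_near sF Uq) => z /FG [].
Qed.

Lemma conj_idem (R : realType) (n : nat) (A B E : 'M[R]_n) :
  B *m A = 1%:M -> E *m E = E -> (A *m E *m B) *m (A *m E *m B) = A *m E *m B.
Proof.
move=> BA EE; rewrite !mulmxA -(mulmxA _ B) BA mulmx1.
by rewrite -(mulmxA A E) EE.
Qed.

(* In a slice chart [F] with inverse [G], [u |-> u *m slice_idem m F G q] is the
   oblique projector dG . (projection onto R^m x {0}) . dF onto the tangent space. *)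
Definition slice_idem (R : realType) (n m : nat) (F G : 'rV[R]_n -> 'rV[R]_n)
    (q : 'rV[R]_n) : 'M[R]_n :=
  jac F q *m pid_mx m *m jac G (F q).

Section SliceChart.
Variables (R : realType) (n m : nat) (M U V : set 'rV[R]_n).
Variables (F G : 'rV[R]_n -> 'rV[R]_n).
Hypotheses (mn : (m <= n)%N) (sF : smooth U F) (sG : smooth V G).
Hypothesis FG : forall q, U q -> V (F q) /\ G (F q) = q.
Hypothesis GF : forall z, V z -> U (G z) /\ F (G z) = z.
Hypothesis MU : forall q, U q ->
  (M q <-> forall i : 'I_n, (m <= i)%N -> F q 0 i = 0).

Lemma slice_idemK q : U q ->
  slice_idem m F G q *m slice_idem m F G q = slice_idem m F G q.
Proof.
move=> Uq; have [VFq GFq] := FG Uq.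
have := jac_inverse sG sF GF VFq; rewrite GFq => J1.
exact: conj_idem J1 (pid_mx_id _ _ _ mn).
Qed.

(** Read in the chart, a curve in [M] moves in [R^m x {0}], and so does its velocity; conversely,
    such a velocity is realized by the image under [G] of a straight line. *)
Lemma tangent_slice_idem q u : U q -> M q ->
  tangent_space M q u <-> u *m slice_idem m F G q = u.
Proof.
move=> Uq Mq; have [VFq GFq] := FG Uq.
have dF := smooth_differentiable sF Uq; have dG := smooth_differentiable sG VFq.
split=> [[c [[U0 U00 sc] cM c0 cu]]|hu].
  have dc := smooth_differentiable sc U00.
  have dFc : differentiable F (c 0) by rewrite c0.
  have cU : \forall t \near (0 : R), U (c t).
    have := smooth_continuous sc U00; apply; rewrite c0; exact: smooth_near sF Uq.
  (* The coordinates of [F \o c] of index at least [m] vanish near [0], hence so do their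
     derivatives. *)
  have hz : u *m jac F q *m pid_mx m = u *m jac F q.
    rewrite mul_jac //; apply/rowP => j.
    rewrite mxE (bigD1 j) //= !mxE eqxx /= big1 ?addr0; last first.
      by move=> i /negPf ij; rewrite mxE -val_eqE /= in ij *; rewrite ij mulr0.
    case: ltnP => jm; rewrite ?mulr1 // mulr0 -cu -c0 -derive_comp //.
    rewrite -derive_entry; last exact: differentiable_comp.
    rewrite (@near_eq_derive _ _ _ _ (fun=> 0)) ?derive_cst //.
    near=> t; have /(_ _) := MU (near cU t _); rewrite /comp => h.
    by apply: (h _).1 => //; near: t.
  by rewrite /slice_idem !mulmxA hz -mulmxA (jac_inverse sF sG FG Uq) mulmx1.
(* [w] is the slice component of the image of [u] under dF; the line [l] through [F q] with velocity
   [w] stays in [R^m x {0}]. *)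
pose w : 'rV[R]_n := u *m jac F q *m pid_mx m.
pose l (t : R) := F q + t *: w.
have Jw : w *m jac G (F q) = u by rewrite -[RHS]hu /w /slice_idem !mulmxA.
have sl : smooth setT l.
  split; first exact: openT.
  move=> k; apply: CkD; [exact: openT|exact: Ck_cst|apply: CkZl; first exact: openT].
  exact: Ck_id.
have l0 : l 0 = F q by rewrite /l scale0r addr0.
have sGl := smooth_comp sl sG.
have dl : differentiable l 0 by exact: smooth_differentiable sl _.
have Dl : 'D_1 l 0 = w.
  have dw : differentiable (fun t : R => t *: w) 0 by exact: ex_diff.
  rewrite (deriveD _ (diff_derivable dw)); last exact: derivable_cst.
  by rewrite derive_cst add0r (deriveE _ dw) diff_val scale1r.
exists (G \o l); split.
- by exists (setT `&` l @^-1` V) => //; split=> //; rewrite /preimage /= l0.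
- have [oW _] := sGl.
  have nW : \forall t \near (0 : R), V (l t).
    have := smooth_continuous sl I; apply; rewrite l0; exact: smooth_near sG VFq.
  near=> t; have Vlt : V (l t) by near: t.
  have [UG FGl] := GF Vlt; apply/MU => // i mi.
  rewrite /= FGl /l !mxE (MU Uq).1 // add0r big1 ?mulr0 // => j _.
  rewrite [pid_mx _ _ _]mxE; case: eqP => [ji|_]; last by rewrite mulr0.
  by rewrite ltnNge ji mi mulr0.
- by rewrite /= l0.
- by rewrite derive_comp ?l0 // Dl -mul_jac.
Unshelve. all: by end_near. Qed.

End SliceChart.

Section EmbeddedSubmanifold.
Variables (R : realType) (n m : nat) (M : set 'rV[R]_n).
Hypothesis hM : embedded_submanifold m M.

(** Idempotence is stated on a whole ambient neighbourhood, so that the orthogonal projector built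
    from [Q] is smooth off [M] too. *)
Lemma tangent_idem p : M p -> exists (U : set 'rV[R]_n) (Q : 'rV[R]_n -> 'M[R]_n),
  [/\ open U, U p, forall k, Ck U k Q, forall q : 'rV[R]_n, U q -> Q q *m Q q = Q q &
      forall q u : 'rV[R]_n, U q -> M q -> (tangent_space M q u <-> u *m Q q = u)].
Proof.
case: hM => mn h /h [U [V [F [G [Up sF sG [FG GF] MU]]]]].
have oU : open U by case: sF.
exists U, (slice_idem m F G); split=> //.
- move=> k; apply: Ck_mulmx => //.
    by apply: Ck_mulmx => //; [exact: Ck_jac sF|exact: Ck_cst].
  apply: (@Ck_comp _ _ _ _ V) => //; first by move=> z /FG [].
  + by case: sG.
  + exact: Ck_jac sG.
  + by case: sF => _; apply.
- by move=> q Uq; exact: (slice_idemK mn sF sG FG GF Uq).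
- by move=> q u Uq Mq; exact: (tangent_slice_idem sF sG FG GF MU u Uq Mq).
Qed.

(** Tangent vectors, defined through curves, become the fixed vectors of a matrix; this makes the
    tangent space a linear subspace. *)
Lemma tangentP q : M q -> exists Q : 'M[R]_n,
  Q *m Q = Q /\ forall u, tangent_space M q u <-> u *m Q = u.
Proof.
move=> Mq; have [U [Q [_ Uq _ QQ h]]] := tangent_idem Mq.
by exists (Q q); split=> [|u]; [exact: QQ|exact: h].
Qed.

Lemma tangentD q a u w : M q -> tangent_space M q u -> tangent_space M q w ->
  tangent_space M q (a *: u + w).
Proof.
by move=> /tangentP [Q [_ h]] /h hu /h hw; apply/h; rewrite mulmxDl -scalemxAl hu hw.
Qed.

Lemma tangentB q u w : M q -> tangent_space M q u -> tangent_space M q w ->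
  tangent_space M q (u - w).
Proof. by move=> Mq hu hw; rewrite addrC -scaleN1r; exact: tangentD. Qed.

Lemma tangent0 q : M q -> tangent_space M q 0.
Proof. by move=> /tangentP [Q [_ h]]; apply/h; rewrite mul0mx. Qed.

Lemma tangentZ q a u : M q -> tangent_space M q u -> tangent_space M q (a *: u).
Proof. by move=> Mq hu; rewrite -[a *: u]addr0; apply: tangentD => //; exact: tangent0. Qed.

Lemma orth_proj_idemE q (Q : 'M[R]_n) v : M q -> Q *m Q = Q ->
  (forall u, tangent_space M q u <-> u *m Q = u) ->
  orth_proj (tangent_space M q) v = v *m ortho_of_idem Q.
Proof.
move=> Mq QQ h; apply: orth_proj_unique.
- by move=> u1 u2; exact: tangentB.
- by apply/h; exact: ortho_of_idem_range.
- by move=> u /h; exact: ortho_of_idem_orth.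
Qed.

Lemma orth_proj_tangent q v : M q -> tangent_space M q (orth_proj (tangent_space M q) v).
Proof.
move=> Mq; have [Q [QQ h]] := tangentP Mq; rewrite (orth_proj_idemE _ Mq QQ h).
by apply/h; exact: ortho_of_idem_range.
Qed.

Lemma orth_proj_orth q v u : M q -> tangent_space M q u ->
  edot (v - orth_proj (tangent_space M q) v) u = 0.
Proof.
move=> Mq; have [Q [QQ h]] := tangentP Mq; rewrite (orth_proj_idemE _ Mq QQ h).
by move=> /h; exact: ortho_of_idem_orth.
Qed.

Lemma orth_proj_linear q a u v : M q ->
  orth_proj (tangent_space M q) (a *: u + v) =
  a *: orth_proj (tangent_space M q) u + orth_proj (tangent_space M q) v.
Proof.
move=> Mq; have [Q [QQ h]] := tangentP Mq; rewrite !(orth_proj_idemE _ Mq QQ h).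
by rewrite mulmxDl -scalemxAl.
Qed.

Lemma orth_proj_id q v : M q -> tangent_space M q v ->
  orth_proj (tangent_space M q) v = v.
Proof.
move=> Mq Tv; apply: orth_proj_unique => //; first by move=> u w; exact: tangentB.
by move=> u _; rewrite subrr edot0l.
Qed.

(* Constant ambient fields projected to the tangent spaces give global smooth
   fields spanning them, so that no cut-off functions are needed. *)
Lemma vfield_orth_proj a : vfield M (fun q => orth_proj (tangent_space M q) a).
Proof.
split=> [p Mp|p Mp]; last exact: orth_proj_tangent.
have [U [Q [oU Up cQ QQ h]]] := tangent_idem Mp.
exists (fun q => a *m ortho_of_idem (Q q)), U; split=> //.
  split=> // k; apply: Ck_mulmx => //; first exact: Ck_cst.
  apply: Ck_mulmx => //; apply: Ck_invmx => //.
    by move=> q Uq; apply: idem_unitmx; exact: QQ.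
  apply: CkD => //; last exact: Ck_cst.
  by apply: CkD => //; exact: Ck_trmx.
move=> q Uq Mq; rewrite (orth_proj_idemE _ Mq (QQ q Uq)) // => u; exact: h.
Qed.

End EmbeddedSubmanifold.

(** * Derivations along a curve *)

Lemma is_derive_edot (R : realType) (n : nat) (V : normedModType R)
    (X Y : V -> 'rV[R]_n) x v : differentiable X x -> differentiable Y x ->
  is_derive x v (fun z => edot (X z) (Y z))
    (edot ('D_v X x) (Y x) + edot (X x) ('D_v Y x)).
Proof.
move=> dX dY; rewrite /edot.
rewrite (_ : (fun z => _) = \sum_i ((fun z => X z 0 i) * (fun z => Y z 0 i))); last first.
  by apply/funext => z; rewrite fct_sumE.
have dXi i : derivable (fun z => X z 0 i) x v.
  exact/diff_derivable/differentiable_entry.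
have dYi i : derivable (fun z => Y z 0 i) x v.
  exact/diff_derivable/differentiable_entry.
apply: DeriveDef; first by apply: derivable_sum => i; exact: derivableM.
rewrite derive_sum => [|i]; last exact: derivableM.
rewrite -big_split; apply: eq_bigr => i _ /=.
by rewrite (deriveM (dXi i) (dYi i)) !derive_entry // [RHS]addrC ['D_v X x 0 i * _]mulrC.
Qed.

(** The function and its extension agree along a curve in [M], so the chain rule can be applied to
    the smooth extension [g]. *)
Lemma derive_along (R : realType) (n : nat) (W : normedModType R)
    (M : set 'rV[R]_n) (f g : 'rV[R]_n -> W) (c : R -> 'rV[R]_n) t :
  differentiable c t -> (\forall s \near t, M (c s)) ->
  local_extension M (c t) f g -> 'D_1 (f \o c) t = 'D_('D_1 c t) g (c t).
Proof.
move=> dc cM [U [Uct sg gf]].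
rewrite -derive_comp //; last exact: smooth_differentiable sg Uct.
have cU : \forall s \near t, U (c s).
  by apply: (differentiable_continuous dc); exact: smooth_near sg Uct.
apply: near_eq_derive; near=> s; rewrite /= gf //; first by near: s.
by near: s.
Unshelve. all: by end_near. Qed.

(** Every admissible curve gives the value ['D_u g p], so the choice made by [xget] is harmless; a
    curve exists because [u] is tangent. *)
Lemma tderE (R : realType) (n : nat) (M : set 'rV[R]_n) (f g : 'rV[R]_n -> R) p u :
  tangent_space M p u -> local_extension M p f g -> tder M f p u = 'D_u g p.
Proof.
move=> [c0 hc0] fg.
have E c : curve_germ M p u c -> 'D_1 (f \o c) 0 = 'D_u g p.
  case=> [[U U0 sc] cM c0p cu]; rewrite -c0p in fg.
  by rewrite (derive_along (smooth_differentiable sc U0) cM fg) cu c0p.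
rewrite /tder; case: xgetP => [d _ [c hc ->]|/(_ ('D_1 (f \o c0) 0)) []]; first exact: E.
by exists c0.
Qed.

Lemma orth_proj_sum (R : realType) (n m : nat) (M : set 'rV[R]_n)
    (hM : embedded_submanifold m M) q v : M q ->
  orth_proj (tangent_space M q) v =
  \sum_i v 0 i *: orth_proj (tangent_space M q) (delta_mx 0 i).
Proof.
move=> Mq; have [Q [QQ h]] := tangentP hM Mq.
rewrite (orth_proj_idemE hM _ Mq QQ h) mulmx_sum_row; apply: eq_bigr => i _.
by rewrite (orth_proj_idemE hM _ Mq QQ h) rowE.
Qed.

Section Along.
Variables (R : realType) (n m : nat) (M : set 'rV[R]_n).
Hypothesis hM : embedded_submanifold m M.
Variables (gamma : R -> 'rV[R]_n) (I : set R).
Hypotheses (oI : open I) (sgamma : smooth_on I gamma)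
  (gM : forall t, I t -> M (gamma t)).

Let P a q := orth_proj (tangent_space M q) a.

Lemma vfield_along_restrict X : vfield M X -> vfield_along M gamma I (X \o gamma).
Proof.
move=> [sX tX]; split; first exact: smooth_on_comp sgamma gM sX.
by move=> t It; apply/tX/gM.
Qed.

Lemma vfield_alongD Y Z : vfield_along M gamma I Y -> vfield_along M gamma I Z ->
  vfield_along M gamma I (fun s => Y s + Z s).
Proof.
move=> [sY tY] [sZ tZ]; split; first exact: smooth_onD.
move=> t It; rewrite -[Y t]scale1r; apply: (tangentD hM) (gM It) (tY t It) (tZ t It).
Qed.

Lemma vfield_alongZ (g : R -> R) Z : smooth_on I g -> vfield_along M gamma I Z ->
  vfield_along M gamma I (fun s => g s *: Z s).
Proof.
move=> sg [sZ tZ]; split; first exact: smooth_onZ.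
by move=> t It; apply: (tangentZ hM) (gM It) (tZ t It).
Qed.

Lemma vfield_along0 : vfield_along M gamma I (fun=> 0).
Proof. by split=> [|t It]; [exact: smooth_on_cst|exact: (tangent0 hM) (gM It)]. Qed.

Lemma vfield_along_sum (r : seq 'I_n) (c : 'I_n -> R -> R) Y :
  (forall i, smooth_on I (c i)) -> (forall i, vfield_along M gamma I (Y i)) ->
  vfield_along M gamma I (fun s => \sum_(i <- r) c i s *: Y i s).
Proof.
move=> sc vY; elim: r => [|i r IH].
  by under eq_fun do rewrite big_nil; exact: vfield_along0.
under eq_fun do rewrite big_cons.
by apply: vfield_alongD => //; exact: vfield_alongZ.
Qed.

Section Derivation.
Variable L : (R -> 'rV[R]_n) -> R -> 'rV[R]_n.
Hypothesis Lext : forall Y Z, vfield_along M gamma I Y -> vfield_along M gamma I Z ->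
  (forall t, I t -> Y t = Z t) -> forall t, I t -> L Y t = L Z t.
Hypothesis Llin : forall (a : R) Y Z, vfield_along M gamma I Y ->
  vfield_along M gamma I Z -> forall t, I t ->
  L (fun s => a *: Y s + Z s) t = a *: L Y t + L Z t.
Hypothesis Lleib : forall (g : R -> R) Z, smooth_on I g -> vfield_along M gamma I Z ->
  forall t, I t -> L (fun s => g s *: Z s) t = 'D_1 g t *: Z t + g t *: L Z t.

(** [L] stands for either [D/dt] or [d/dt]. The coefficients vanish at [t], so the Leibniz rule
    leaves only the terms with their derivatives. *)
Lemma derivation_sum (r : seq 'I_n) (c : 'I_n -> R -> R) Y t : I t ->
  (forall i, smooth_on I (c i)) -> (forall i, vfield_along M gamma I (Y i)) ->
  (forall i, c i t = 0) ->
  L (fun s => \sum_(i <- r) c i s *: Y i s) t = \sum_(i <- r) 'D_1 (c i) t *: Y i t.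
Proof.
move=> It sc vY c0; elim: r => [|i r IH].
  under eq_fun do rewrite big_nil; rewrite big_nil.
  (* Linearity at the zero field reads [L 0 = L 0 + L 0], whence [L 0 = 0]. *)
  have := Llin 1 vfield_along0 vfield_along0 It.
  under eq_fun do rewrite scaler0 addr0.
  by rewrite scale1r -{1}[L _ _]addr0 => /addrI <-.
under eq_fun do rewrite big_cons -[_ *: _ in X in X + _]scale1r.
rewrite big_cons (Llin 1) //; first 1 last.
- exact: vfield_alongZ.
- exact: vfield_along_sum.
by rewrite Lleib // c0 scale0r addr0 scale1r IH.
Qed.

(* Expand [Z s = P (Z t) (gamma s) + \sum_i (Z s - Z t)_i P e_i (gamma s)]: the
   coefficients of the sum vanish at [s = t]. *)
Lemma derivation_split Z t : vfield_along M gamma I Z -> I t ->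
  L Z t = P ('D_1 Z t) (gamma t) + L (P (Z t) \o gamma) t.
Proof.
move=> vZ It; have [sZ tZ] := vZ.
pose c (i : 'I_n) s := Z s 0 i - Z t 0 i.
pose E (i : 'I_n) := P (delta_mx 0 i) \o gamma.
have sc i : smooth_on I (c i).
  by apply: smooth_onD; [exact: smooth_on_entry|exact: smooth_on_cst].
have vE i : vfield_along M gamma I (E i).
  exact/vfield_along_restrict/(vfield_orth_proj hM).
have vP : vfield_along M gamma I (P (Z t) \o gamma).
  exact/vfield_along_restrict/(vfield_orth_proj hM).
have vS := vfield_along_sum (index_enum 'I_n) sc vE.
have dZ : differentiable Z t.
  by apply: smooth_on_differentiable sZ _; exact: open_nbhs_nbhs.
transitivity (L (fun s => 1 *: (\sum_i c i s *: E i s) + (P (Z t) \o gamma) s) t).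
  apply: Lext => //.
    by under eq_fun do rewrite scale1r; exact: vfield_alongD.
  move=> s Is; have Ms := gM Is.
  rewrite scale1r -[LHS](orth_proj_id hM Ms (tZ s Is)) /= /P.
  rewrite (orth_proj_sum hM _ Ms) (orth_proj_sum hM (Z t) Ms) -big_split /=.
  by apply: eq_bigr => i _; rewrite /E /= -scalerDl /c subrK.
rewrite Llin // scale1r derivation_sum // => [|i]; last by rewrite /c subrr.
congr (_ + _); rewrite /P (orth_proj_sum hM _ (gM It)); apply: eq_bigr => i _.
congr (_ *: _); rewrite /c.
have dZi : derivable (fun s => Z s 0 i) t 1.
  exact/diff_derivable/differentiable_entry.
rewrite (deriveB dZi); last exact: derivable_cst.
by rewrite derive_cst subr0 derive_entry.
Qed.

End Derivation.

End Along.

(** * Parallel fields *)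

Section ParallelField.
Variables (R : realType) (n m : nat) (M : set 'rV[R]_n).
Variable nabla : 'rV[R]_n -> 'rV[R]_n -> ('rV[R]_n -> 'rV[R]_n) -> 'rV[R]_n.
Hypotheses (hM : embedded_submanifold m M) (hnabla : levi_civita M nabla).
Variables (gamma : R -> 'rV[R]_n) (I : set R).
Hypotheses (oI : open I) (sgamma : smooth_on I gamma)
  (gM : forall t, I t -> M (gamma t))
  (gT : forall t, I t -> tangent_space M (gamma t) ('D_1 gamma t)).
Variable Z : R -> 'rV[R]_n.
Hypothesis hZ : parallel M nabla gamma I Z.

Let P a q := orth_proj (tangent_space M q) a.

Let vP a : vfield M (P a) := vfield_orth_proj hM a.

Let near_I t : I t -> nbhs t I.
Proof. by move=> It; exact: open_nbhs_nbhs. Qed.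

Let dgamma t : I t -> differentiable gamma t.
Proof. by move=> It; exact: smooth_on_differentiable sgamma (near_I It). Qed.

Let near_M t : I t -> \forall s \near t, M (gamma s).
Proof. by move=> It; apply: filterS (near_I It) => s; exact: gM. Qed.

Lemma differentiable_along X t : vfield_along M gamma I X -> I t -> differentiable X t.
Proof. by move=> [sX _] It; exact: smooth_on_differentiable sX (near_I It). Qed.

Lemma parallel_derive t : I t ->
  'D_1 Z t = 'D_1 (P (Z t) \o gamma) t - nabla (gamma t) ('D_1 gamma t) (P (Z t)).
Proof.
move=> It; have [vZ [D [_ Dext Dlin Dleib Dres] DZ]] := hZ.
have E1 := derivation_split hM oI sgamma gM Dext Dlin Dleib vZ It.
(* Since [D Z t = 0], [E1] determines the tangential part of ['D_1 Z t], which is also the first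
   term of [E2]. *)
rewrite DZ // (Dres _ (vP _)) // in E1.
have E2 : 'D_1 Z t = P ('D_1 Z t) (gamma t) + 'D_1 (P (Z t) \o gamma) t.
  apply: (derivation_split hM oI sgamma gM (L := fun Y => 'D_1 Y)) => //.
  - move=> Y1 Y2 _ _ Y12 s Is; apply: near_eq_derive.
    by apply: filterS (near_I Is) => r; exact: Y12.
  - move=> a Y1 Y2 v1 v2 s Is.
    have d1 : derivable Y1 s 1 by exact/diff_derivable/differentiable_along.
    have d2 : derivable Y2 s 1 by exact/diff_derivable/differentiable_along.
    by rewrite (deriveD (derivableZ (k := a) d1) d2) deriveZ.
  - move=> g Y sg vY s Is.
    have dg := smooth_on_differentiable sg (near_I Is).
    have dY := differentiable_along vY Is.
    apply/rowP => i; rewrite -derive_entry; last first.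
      apply: smooth_on_differentiable (near_I Is).
      exact: smooth_onZ sg vY.1.
    under eq_fun do rewrite mxE.
    rewrite !mxE -[('D_1 Y s) 0 i]derive_entry //.
    have dYi : derivable (fun r => Y r 0 i) s 1.
      exact/diff_derivable/differentiable_entry.
    by rewrite (deriveM (diff_derivable dg) dYi) [RHS]addrC ['D_1 g s * _]mulrC.
have E3 : P ('D_1 Z t) (gamma t) = - nabla (gamma t) ('D_1 gamma t) (P (Z t)).
  by apply/eqP; rewrite -addr_eq0 /P -E1.
by rewrite {1}E2 E3 addrC.
Qed.

(** Metric compatibility for [P (Z t)] paired with itself says that its ambient and covariant
    derivatives along [gamma] have the same inner product with [Z t]; their difference is
    ['D_1 Z t]. *)
Lemma parallel_orth t : I t -> edot (Z t) ('D_1 Z t) = 0.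
Proof.
move=> It; have Mt := gM It; have Tt := gT It.
have [_ _ metric] := hnabla.
have [X [U [Ut sX hX]]] := (vP (Z t)).1 _ Mt.
have Zt : P (Z t) (gamma t) = Z t by exact: (orth_proj_id hM Mt (hZ.1.2 t It)).
have Xt : X (gamma t) = Z t by rewrite hX.
have lX : local_extension M (gamma t) (P (Z t)) X by exists U.
have dX := smooth_differentiable sX Ut.
have := metric _ _ _ _ Mt Tt (vP (Z t)) (vP (Z t)).
rewrite (@tderE _ _ _ _ (fun q => edot (X q) (X q))) //; last first.
  exists U; split=> //; last by move=> q Uq Mq; rewrite hX.
  by have [oU cX] := sX; split=> // k; exact: Ck_edot.
have [_ ->] := is_derive_edot ('D_1 gamma t) dX dX.
rewrite (parallel_derive It) (derive_along (dgamma It) (near_M It) lX) edotBr Zt.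
rewrite Xt (edotC (nabla _ _ _)) (edotC ('D_('D_1 gamma t) X _)) => h.
by lra.
Qed.

(** Projections are linear in the vector at points of [M], so the field is first replaced by one
    that agrees with it on [M]. *)
Lemma nabla_projD p u a w1 w2 : M p -> tangent_space M p u ->
  nabla p u (P (a *: w1 + w2)) = a *: nabla p u (P w1) + nabla p u (P w2).
Proof.
move=> Mp Tu; have [[[_ c1] _ _ c4 _] _ _] := hnabla.
rewrite -c4 //; apply: c1 => // [|q Mq]; last exact: (orth_proj_linear hM).
split.
  apply: smooth_onD (vP w2).1; apply: smooth_onZ (vP w1).1; exact: smooth_on_cst.
by move=> q Mq; apply: (tangentD hM) => //; exact: (orth_proj_tangent hM).
Qed.

Lemma nabla_projZ p u a w : M p -> tangent_space M p u ->
  nabla p u (P (a *: w)) = a *: nabla p u (P w).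
Proof.
(* At zero vectors additivity reads [n = n + n], so [nabla] vanishes on [P 0]. *)
move=> Mp Tu; have := nabla_projD 1 0 0 Mp Tu.
rewrite scaler0 addr0 scale1r -{1}[nabla _ _ _]addr0 => /addrI n0.
by have := nabla_projD a w 0 Mp Tu; rewrite -n0 !addr0.
Qed.

Lemma nablaZ p u a w : M p -> tangent_space M p u ->
  nabla p (a *: u) (P w) = a *: nabla p u (P w).
Proof.
move=> Mp Tu; have [[_ _ c3 _ _] _ _] := hnabla.
have T0 := tangent0 hM Mp.
have := c3 p 0 0 1 (P w) Mp T0 T0 (vP w).
rewrite scaler0 addr0 scale1r -{1}[nabla _ _ _]addr0 => /addrI n0.
by have := c3 p u 0 a (P w) Mp Tu T0 (vP w); rewrite -n0 !addr0.
Qed.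

Variable C : R.
Hypothesis hC : forall p xi eta b : 'rV[R]_n, M p ->
       tangent_space M p xi -> tangent_space M p eta ->
       enorm xi = 1 -> enorm eta = 1 ->
       second_fform M nabla p xi eta b -> enorm b <= C.

(** The bound [hC] concerns unit vectors: [Z t] and the velocity are normalized to [w] and [u], and
    their norms are pulled out by bilinearity. *)
Lemma parallel_derive_le t : I t -> enorm (Z t) != 0 ->
  enorm ('D_1 Z t) <= C * enorm (Z t) * enorm ('D_1 gamma t).
Proof.
move=> It Z0; have Mt := gM It; have Tt := gT It.
have TZ := hZ.1.2 t It.
set z := enorm (Z t) in Z0 *; set g := enorm ('D_1 gamma t).
pose w := z^-1 *: Z t.
have Zw : Z t = z *: w by rewrite /w scalerA divff // scale1r.
have Tw : tangent_space M (gamma t) w by exact: (tangentZ hM).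
have [X [U [Ut sX hX]]] := (vP w).1 _ Mt.
have lX : local_extension M (gamma t) (P w) X by exists U.
have dX := smooth_differentiable sX Ut.
have DZ : 'D_1 Z t = z *: ('D_('D_1 gamma t) X (gamma t)
    - nabla (gamma t) ('D_1 gamma t) (P w)).
  rewrite (parallel_derive It) scalerBr {1 2}Zw nabla_projZ //; congr (_ - _).
  rewrite -(derive_along (dgamma It) (near_M It) lX) -deriveZ; last first.
    apply: diff_derivable; apply: (differentiable_along _ It).
    exact: vfield_along_restrict.
  apply: near_eq_derive; apply: filterS (near_M It) => s Ms.
  rewrite /= -[z *: w]addr0 /P (orth_proj_linear hM) //.
  by rewrite (orth_proj_id hM Ms (tangent0 hM Ms)) addr0.
(* A zero velocity cannot be normalized; both terms of [DZ] then vanish by linearity in the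
   direction. *)
have [g0|g0] := eqVneq g 0.
  rewrite g0 mulr0 DZ (enorm_eq0 g0).
  have := nablaZ 0 w Mt (tangent0 hM Mt); rewrite !scale0r => ->.
  by rewrite derive0 subr0 scaler0 /enorm edot0l sqrtr0.
pose u := g^-1 *: 'D_1 gamma t.
have gu : 'D_1 gamma t = g *: u by rewrite /u scalerA divff // scale1r.
have Tu : tangent_space M (gamma t) u by exact: (tangentZ hM).
have unit (x : 'rV[R]_n) : enorm x != 0 -> enorm ((enorm x)^-1 *: x) = 1.
  by move=> x0; rewrite enormZ ger0_norm ?invr_ge0 ?enorm_ge0 // mulVf.
have [X' [U' [Ut' sX' hX']]] := (vP u).1 _ Mt.
have : enorm ('D_u X (gamma t) - nabla (gamma t) u (P w)) <= C.
  apply: (hC Mt Tu Tw (unit _ g0) (unit _ Z0)).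
  have Pu : P u (gamma t) = u by exact: (orth_proj_id hM).
  exists (P u), (P w), X', X; split=> //.
  - by split=> //; exact: (orth_proj_id hM).
  - by exists U'.
  - by rewrite hX' // Pu.
have -> : enorm ('D_1 Z t) =
    z * g * enorm ('D_u X (gamma t) - nabla (gamma t) u (P w)).
  rewrite DZ gu nablaZ // !(deriveE _ dX) linearZ /= -scalerBr scalerA enormZ.
  by rewrite ger0_norm ?mulr_ge0 ?enorm_ge0 // (deriveE _ dX).
move=> h; rewrite -[leRHS]mulrA [leRHS]mulrC; apply: ler_wpM2l => //.
by rewrite mulr_ge0 ?enorm_ge0.
Qed.

End ParallelField.

(** * The comparison along a minimal geodesic *)

Section SmoothPaths.
Variables (R : realType) (n : nat) (a b : R).
Hypothesis ab : a < b.

Lemma itvoo_nbhs t : itvoo a b t -> nbhs t (itvoo a b).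
Proof. by move=> h; apply: open_nbhs_nbhs; split=> //; exact: interval_open. Qed.

Lemma itvoo_sub : itvoo a b `<=` itvcc a b.
Proof. exact: subset_itv_oo_cc. Qed.

(** An inner product is used because the mean value theorem holds as an equality for scalar
    functions only. *)
Lemma edot_MVT (X Y : R -> 'rV[R]_n) :
  smooth_on (itvcc a b) X -> smooth_on (itvcc a b) Y ->
  exists2 t, itvoo a b t &
    edot (X b) (Y b) - edot (X a) (Y a) =
    (edot ('D_1 X t) (Y t) + edot (X t) ('D_1 Y t)) * (b - a).
Proof.
move=> sX sY.
have [t t01 E] := @MVT _ (fun s => edot (X s) (Y s))
  (fun t => edot ('D_1 X t) (Y t) + edot (X t) ('D_1 Y t)) a b ab
  (fun t h => is_derive_edot (1 : R)
     (smooth_on_differentiable (smooth_on_subset itvoo_sub sX) (itvoo_nbhs h))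
     (smooth_on_differentiable (smooth_on_subset itvoo_sub sY) (itvoo_nbhs h)))
  (smooth_on_within_continuous (smooth_on_edot sX sY)).
by exists t.
Qed.

Lemma enorm_constant (Z : R -> 'rV[R]_n) : smooth_on (itvcc a b) Z ->
  (forall t, itvoo a b t -> edot (Z t) ('D_1 Z t) = 0) -> enorm (Z a) = enorm (Z b).
Proof.
move=> sZ h; have [t /h t0] := edot_MVT sZ sZ.
rewrite edotC t0 addr0 mul0r => /eqP; rewrite subr_eq0 => /eqP E.
by rewrite /enorm E.
Qed.

End SmoothPaths.

(** Pythagoras: [v - w] is the sum of [v - p] and the tangent vector [p - w], which are
    orthogonal. *)
Lemma orth_proj_dist_le (R : realType) (n m : nat) (M : set 'rV[R]_n)
    (q v w : 'rV[R]_n) : embedded_submanifold m M -> M q -> tangent_space M q w ->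
  enorm (orth_proj (tangent_space M q) v - w) <= enorm (v - w).
Proof.
move=> hM Mq Tw; set p := orth_proj _ v.
have Tp : tangent_space M q p by exact: (orth_proj_tangent hM).
have o : edot (v - p) (p - w) = 0.
  by apply: (orth_proj_orth hM) => //; exact: (tangentB hM).
have E : v - w = (v - p) + (p - w) by rewrite subrKA.
rewrite ler_sqrt ?edot_ge0 // E; move: (v - p) (p - w) o => a b o.
rewrite edotDl !edotDr (edotC b a) o.
by rewrite addr0 add0r lerDr edot_ge0.
Qed.

(** At [0] and [1] the derivative depends on values of [c] outside the interval, so the integral is
    moved to the open interval, which differs by a null set. *)
Lemma curve_length_constant_speed (R : realType) (n : nat) (c : R -> 'rV[R]_n) s :
  (forall t, itvoo 0 1 t -> enorm ('D_1 c t) = s) -> curve_length c = s%:E.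
Proof.
move=> hs; rewrite /curve_length /itvcc integral_itv_bndoo; last first.
  apply/measurable_EFinP.
  apply: (eq_measurable_fun (cst s : measurableTypeR R -> R)) => [t|].
    by rewrite inE => /hs ->.
  exact: measurable_cst.
rewrite (eq_integral (cst s%:E)) => [|t]; last by rewrite inE => /hs ->.
rewrite integral_cst //= lebesgue_measure_itv /= lte_fin ltr01 oppr0 adde0.
by rewrite mule1.
Qed.

Theorem theorem4p1 (R : realType) (n m : nat) (M : set 'rV[R]_n)
    (nabla : 'rV[R]_n -> 'rV[R]_n -> ('rV[R]_n -> 'rV[R]_n) -> 'rV[R]_n)
    (C : R)
    (hM : embedded_submanifold m M)
    (hcomplete : complete_submanifold M)
    (hnabla : levi_civita M nabla)
    (hC : forall p xi eta b : 'rV[R]_n, M p ->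
       tangent_space M p xi -> tangent_space M p eta ->
       enorm xi = 1 -> enorm eta = 1 ->
       second_fform M nabla p xi eta b -> enorm b <= C)
    (x y : 'rV[R]_n) (hx : M x) (hy : M y)
    (gamma : R -> 'rV[R]_n) (hgamma : minimal_geodesic M nabla x y gamma)
    (v w : 'rV[R]_n) (hv : tangent_space M x v)
    (hw : parallel_transport M nabla gamma v w) :
  ((enorm (orth_proj (tangent_space M y) v - w))%:E
     <= (C * enorm v)%:E * geodesic_dist M x y)%E.
Proof.
have [[sg gM pg] g0 g1 <-] := hgamma.
have [Z [[sZ tZ] pZ Z0 Z1]] := hw.
have i1 : itvcc 0 1 (1 : R) by rewrite /itvcc /= in_itv /= ler01 lexx.
have Tw : tangent_space M y w by rewrite -g1 -Z1; exact: tZ.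
have oI : open (itvoo 0 1 : set R) by exact: interval_open.
have subI : itvoo 0 1 `<=` (itvcc 0 1 : set R) by exact: itvoo_sub.
have sgI := smooth_on_subset subI sg.
have gMI t : itvoo 0 1 t -> M (gamma t) by move=> /subI /gM.
have gTI : forall t, itvoo 0 1 t -> tangent_space M (gamma t) ('D_1 gamma t) := pg.1.2.
(* The velocity is given as smooth on the open interval only, so speeds are compared on closed
   subintervals inside it. *)
have sub_itv (a b : R) : 0 < a -> b < 1 -> itvcc a b `<=` itvoo 0 1.
  move=> a0 b1 t; rewrite /itvcc /itvoo /= !in_itv /= => /andP [at_ tb].
  by rewrite (lt_le_trans a0 at_) (le_lt_trans tb b1).
pose s := enorm ('D_1 gamma (2^-1)).
have speed_mono a b : 0 < a -> a < b -> b < 1 ->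
    enorm ('D_1 gamma a) = enorm ('D_1 gamma b).
  move=> a0 ab b1; apply: (enorm_constant (Z := 'D_1 gamma) ab).
    exact: smooth_on_subset (sub_itv a b a0 b1) pg.1.1.
  move=> t /itvoo_sub /(sub_itv a b a0 b1) tI.
  exact: (parallel_orth hM hnabla oI sgI gMI gTI pg tI).
have speed t : itvoo 0 1 t -> enorm ('D_1 gamma t) = s.
  rewrite /itvoo /= in_itv /= => /andP [t0 t1]; rewrite /s.
  have h0 : 0 < 2^-1 :> R by lra.
  have h1 : 2^-1 < 1 :> R by lra.
  by have [tl|tl|->//] := ltgtP t 2^-1; [|apply/esym]; exact: speed_mono.
rewrite (curve_length_constant_speed speed) -EFinM lee_fin.
apply: le_trans (orth_proj_dist_le v hM hy Tw) _.
(* Unlike the velocity, [Z] is smooth up to [0], so its norm at [t] is compared directly with that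
   of [v]. *)
have Znorm t : itvoo 0 1 t -> enorm (Z t) = enorm v.
  rewrite /itvoo /= in_itv /= => /andP [t0 t1].
  rewrite -Z0; apply/esym; apply: (enorm_constant (Z := Z) t0).
    apply: smooth_on_subset sZ => r; rewrite /itvcc /= !in_itv /= => /andP [-> rt].
    by rewrite ltW // (le_lt_trans rt).
  move=> r; rewrite /itvoo /= in_itv /= => /andP [r0 rt].
  have rI : itvoo 0 1 r by rewrite /itvoo /= in_itv /= r0 (lt_trans rt t1).
  exact: (parallel_orth hM hnabla oI sgI gMI gTI pZ rI).
have w0 : enorm v = enorm w.
  rewrite -Z0 -Z1; apply: (enorm_constant ltr01 sZ) => t tI.
  exact: (parallel_orth hM hnabla oI sgI gMI gTI pZ tI).
(* If [v = 0] then [w = 0]; otherwise [Z t] is nonzero at every interior time and can be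
   normalized. *)
have [v0|v0] := eqVneq (enorm v) 0.
  rewrite v0 mulr0 mul0r (enorm_eq0 v0) (enorm_eq0 (etrans (esym w0) v0)).
  by rewrite subrr /enorm edot0l sqrtr0.
(* Pairing [Z] with the constant [w - v] gives a scalar function of increment [|w - v|^2], which
   thus equals the inner product of [w - v] and ['D_1 Z t] at some [t]. *)
have [t tI] := edot_MVT ltr01 (@smooth_on_cst R R _ (itvcc 0 1) (w - v)) sZ.
rewrite derive_cst edot0l add0r subr0 mulr1 Z0 Z1 -edotBr => E.
have Zt0 : enorm (Z t) != 0 by rewrite Znorm.
have := parallel_derive_le hM hnabla oI sgI gMI gTI pZ hC tI Zt0.
rewrite Znorm // speed // => le_DZ.
have -> : v - w = -1 *: (w - v) by rewrite scaleN1r opprB.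
rewrite enormZ normrN1 mul1r.
have le_sqr : enorm (w - v) ^+ 2 <= enorm (w - v) * (C * enorm v * s).
  rewrite enorm_sqr E; apply: le_trans (edot_le _ _) _.
  by apply: ler_wpM2l => //; exact: enorm_ge0.
(* No sign of [C] is assumed: for [w = v] the bound is nonnegative because [le_DZ] puts it above a
   norm. Otherwise a factor [|w - v|] cancels. *)
have [->|wv] := eqVneq (enorm (w - v)) 0; first exact: le_trans (enorm_ge0 _) le_DZ.
have wv0 : 0 < enorm (w - v) by rewrite lt_neqAle eq_sym wv enorm_ge0.
by move: le_sqr; rewrite expr2 ler_pM2l.
Qed.
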